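(* Let $\mathcal{X}$ be a set and let $(\mathcal{X}^{\Omega_n})_{n\ge0}$ be families of maps $\Omega_n\to\mathcal{X}$ containing the constants and closed under precomposition with $\mathbb{S}$-morphisms. Then there is exactly one way to extend them to families $\mathcal{X}^{\mathbb{R}^n}$ of maps $\mathbb{R}^n\to\mathcal{X}$, $n\ge0$, so that the whole is closed under precomposition with $\mathbb{S}_*$-morphisms, namely $$\mathcal{X}^{\mathbb{R}^n}=\{\gamma:\mathbb{R}^n\to\mathcal{X}\ :\ \gamma\circ\pi\in\mathcal{X}^{\Omega_n}\},\qquad \pi=\mathrm{pr}_{\mathbb{R}^n}:\Omega_n\to\mathbb{R}^n,$$ and it satisfies $\mathcal{X}^{*}=\mathcal{X}$, where $*=\mathbb{R}^0$ (maps $*\to\mathcal{X}$ being identified with points of $\mathcal{X}$). Consequently the categories of such structures over $\mathbb{S}$ and over $\mathbb{S}_*$ (with morphisms the maps of underlying sets that carry admissible maps to admissible maps by postcomposition) are isomorphic.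
   Context: **Sample space.** $\Omega=[0,1]^{\mathbb{N}}$; $\mathcal{B}_\Omega$ is the universal completion of its Borel (product) $\sigma$-algebra, i.e. all universally measurable subsets; $\Omega^\Omega$ is the set of all $\mathcal{B}_\Omega$-$\mathcal{B}_\Omega$-measurable self-maps of $\Omega$. **Site $\mathbb{S}$.** $\Omega_n:=\mathbb{R}^n\times\Omega$, $n\ge0$ ($\Omega_0=\Omega$). A map $g:\Omega_m\to\mathbb{R}^n$ is mixed-smooth, $g\in\mathcal{C}^\infty_{\mathrm{mix}}(\Omega_m,\mathbb{R}^n)$, if (M1) $g(-,\omega)\in C^\infty(\mathbb{R}^m,\mathbb{R}^n)$ for every $\omega$, and (M2) $g(t,-)$ is $\mathcal{B}_\Omega$-Borel measurable for every $t$. The category $\mathbb{S}$ has objects $\Omega_n$, $n\ge0$, and morphisms $\mathbb{S}(\Omega_m,\Omega_n)=\{(g,\Phi): g\in\mathcal{C}^\infty_{\mathrm{mix}}(\Omega_m,\mathbb{R}^n),\Phi\in\Omega^\Omega\}$, where $(g,\Phi)(t,\omega)=(g(t,\omega),\Phi(\omega))$, composed as maps. **Enlarged site $\mathbb{S}_*$.** Objects $\Omega_n$ and $\mathbb{R}^n$, $n\ge0$, with $\mathbb{R}^0=*$ the one-point space. Morphisms (maps of sets, composed as such): $\mathbb{S}_*(\Omega_m,\Omega_n)=\mathbb{S}(\Omega_m,\Omega_n)$; $\mathbb{S}_*(\Omega_m,\mathbb{R}^n)=\mathcal{C}^\infty_{\mathrm{mix}}(\Omega_m,\mathbb{R}^n)$;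 $\mathbb{S}_*(\mathbb{R}^m,\mathbb{R}^n)=C^\infty(\mathbb{R}^m,\mathbb{R}^n)$; $\mathbb{S}_*(\mathbb{R}^m,\Omega_n)=C^\infty(\mathbb{R}^m,\mathbb{R}^n)\times\Omega$, the pair $(\varphi,\omega_0)$ being the map $t\mapsto(\varphi(t),\omega_0)$. A structure over $\mathbb{S}$ (resp. $\mathbb{S}_*$) on a set $\mathcal{X}$ assigns to each object $C$ a set of maps $C\to\mathcal{X}$ containing the constants, closed under precomposition with morphisms of $\mathbb{S}$ (resp. $\mathbb{S}_*$). *)

(* Defs.v *)
From HB Require Import structures.
From mathcomp Require Import all_boot all_order all_algebra.
From mathcomp Require Import all_classical all_reals all_analysis.
From mathcomp Require Import measurable_realfun.

Set Implicit Arguments.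
Unset Strict Implicit.
Unset Printing Implicit Defensive.

Import Order.TTheory GRing.Theory Num.Theory.
Import numFieldNormedType.Exports.

Local Open Scope classical_set_scope.
Local Open Scope ring_scope.

Definition unit_interval (R : realType) : Type :=
  set_type (`[(0 : R), 1]%classic : set R).

HB.instance Definition _ (R : realType) := Topological.on (unit_interval R).

Lemma unit_interval_zero_subproof (R : realType) :
  (0 : R) \in (`[(0 : R), 1]%classic : set R).
Proof. by rewrite inE /= in_itv /= lexx ler01. Qed.

HB.instance Definition _ (R : realType) := isPointed.Build (unit_interval R)
  (exist _ 0 (unit_interval_zero_subproof R)).

Definition Omega (R : realType) : Type :=
  prod_topology (fun _ : nat => unit_interval R).

HB.instance Definition _ (R : realType) := Topological.on (Omega R).
HB.instance Definition _ (R : realType) :=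
  Pointed.copy (Omega R) (nat -> unit_interval R).

(* Borel sets of the product topology; as [0,1] is second countable they are
   also the sets of the product sigma-algebra. *)
Definition borel_Omega (R : realType) := g_sigma_algebraType (@open (Omega R)).

Section UniversalCompletion.
Variable R : realType.
Implicit Type A : set (Omega R).

(* completed_algebra_gen mu consists of the sets measurable for the completion
   of mu. Probability measures suffice: every sigma-finite nonzero measure has
   the same null sets as some probability measure. *)
Definition universally_measurable A : Prop :=
  forall mu : probability (borel_Omega R) R, completed_algebra_gen mu A.

Lemma universally_measurable0 : universally_measurable set0.
Proof.
move=> mu; exists set0; first exact: measurable0.
by exists set0; [exact: negligible_set0|rewrite setU0].
Qed.

Lemma universally_measurableC A :
  universally_measurable A -> universally_measurable (~` A).
Proof.
move=> mA mu; have [B mB [N [M [mM M0 NM]] <-]] := mA mu.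
exists (~` (B `|` M)); first exact/measurableC/measurableU.
exists (M `\` (B `|` N)); first by exists M; split=> // x [].
apply/seteqP; split=> x /=.
- by case=> [BM [Bx|Nx]|[_ BN] //]; apply: BM; [left|right; exact: NM].
- move=> BN; have [Mx|Mx] := pselect (M x); [by right|left].
  by case=> // Bx; apply: BN; left.
Qed.

Lemma universally_measurable_bigcup (F : (set (Omega R))^nat) :
  (forall i, universally_measurable (F i)) ->
  universally_measurable (\bigcup_i F i).
Proof.
move=> mF mu.
have /choice[BN BNP] : forall i, exists BN : set (borel_Omega R) * set (borel_Omega R),
    [/\ measurable BN.1, mu.-negligible BN.2 & BN.1 `|` BN.2 = F i].
  by move=> i; have [B mB [N N0 BN]] := mF i mu; exists (B, N).
exists (\bigcup_i (BN i).1); first by apply: bigcup_measurable => i _; case: (BNP i).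
exists (\bigcup_i (BN i).2); first by apply: negligible_bigcup => i; case: (BNP i).
by rewrite -bigcupU; apply: eq_bigcupr => i _; case: (BNP i).
Qed.

End UniversalCompletion.

(* The measurable sets of Omega itself are the universally measurable ones; the
   Borel sets are only those of the alias borel_Omega. *)
HB.instance Definition _ (R : realType) :=
  @isMeasurable.Build default_measure_display (Omega R)
    (@universally_measurable R) (@universally_measurable0 R)
    (@universally_measurableC R) (@universally_measurable_bigcup R).

Definition borel_rV (R : realType) (n : nat) :=
  g_sigma_algebraType (@open 'rV[R]_n).

Section Smooth.
Variables (R : realType) (m n : nat).

(* The iterated partial derivatives of f of order at most k exist everywhere and
   are continuous. *)
Fixpoint Ck (k : nat) (f : 'rV[R]_m -> 'rV[R]_n) : Prop :=
  continuous f /\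
  if k is k'.+1 then
    forall i : 'I_m, (forall x, derivable f x (delta_mx 0 i)) /\
                     Ck k' ('D_(delta_mx 0 i) f)
  else True.

Definition smooth (f : 'rV[R]_m -> 'rV[R]_n) : Prop := forall k, Ck k f.

End Smooth.

(* Omega_n = R^n x Omega; Omega_0 is 'rV_0 * Omega, with 'rV_0 a point. *)
Definition Omega_ (R : realType) (n : nat) : Type := ('rV[R]_n * Omega R)%type.

Definition mixed_smooth (R : realType) (m n : nat)
    (g : Omega_ R m -> 'rV[R]_n) : Prop :=
  (forall w, smooth (fun t => g (t, w))) /\
  (forall t, measurable_fun [set: Omega R]
     ((fun w => g (t, w)) : Omega R -> borel_rV R n)).

(* Structures only depend on the underlying sets of the objects and on the
   sets of maps that are morphisms, so these are all that is recorded. *)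
Record concrete_site := ConcreteSite {
  site_obj : Type;
  site_pt : site_obj -> Type;
  site_mor : forall C D, set (site_pt C -> site_pt D) }.

Definition site_S_mor (R : realType) (m n : nat) :
    set (Omega_ R m -> Omega_ R n) :=
  [set h | exists (g : Omega_ R m -> 'rV[R]_n) (Phi : Omega R -> Omega R),
     [/\ mixed_smooth g, measurable_fun [set: Omega R] Phi &
         h = fun p => (g p, Phi p.2)]].

Definition site_S (R : realType) : concrete_site :=
  @ConcreteSite nat (Omega_ R) (@site_S_mor R).

Inductive star_obj := OmegaObj of nat | RealObj of nat.

Definition star_pt (R : realType) (C : star_obj) : Type :=
  match C with OmegaObj n => Omega_ R n | RealObj n => 'rV[R]_n end.

Definition star_mor (R : realType) (C D : star_obj) :
    set (star_pt R C -> star_pt R D) :=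
  match C, D return set (star_pt R C -> star_pt R D) with
  | OmegaObj m, OmegaObj n => @site_S_mor R m n
  | OmegaObj m, RealObj n => @mixed_smooth R m n
  | RealObj m, RealObj n => @smooth R m n
  | RealObj m, OmegaObj n =>
      [set h | exists (phi : 'rV[R]_m -> 'rV[R]_n) (w0 : Omega R),
         smooth phi /\ h = fun t => (phi t, w0)]
  end.

Definition site_S_star (R : realType) : concrete_site :=
  @ConcreteSite star_obj (star_pt R) (@star_mor R).

Section Structures.
Variable S : concrete_site.

Definition map_family (X : Type) := forall C : site_obj S, set (site_pt C -> X).

Definition contains_constants (X : Type) (P : map_family X) : Prop :=
  forall C (x : X), P C (fun=> x).

Definition precomp_closed (X : Type) (P : map_family X) : Prop :=
  forall C D (h : site_pt C -> site_pt D) (a : site_pt D -> X),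
    site_mor h -> P D a -> P C (a \o h).

Definition is_structure (X : Type) (P : map_family X) : Prop :=
  contains_constants P /\ precomp_closed P.

Record structure := Structure {
  str_set :> Type;
  admissible : map_family str_set;
  structureP : is_structure admissible }.

Definition structure_morphism (X Y : structure) (f : X -> Y) : Prop :=
  forall C (a : site_pt C -> X), admissible a -> admissible (f \o a).

Definition structure_hom (X Y : structure) : Type :=
  {f : X -> Y | structure_morphism f}.

Definition structure_id (X : structure) : structure_hom X X :=
  exist (@structure_morphism X X) (fun x => x) (fun C a aP => aP).

Definition structure_comp (X Y Z : structure)
    (g : structure_hom Y Z) (f : structure_hom X Y) : structure_hom X Z :=
  exist (@structure_morphism X Z) (fun x => sval g (sval f x))
    (fun C a aP => svalP g C _ (svalP f C a aP)).

End Structures.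

Record category := Category {
  cat_obj :> Type;
  cat_hom : cat_obj -> cat_obj -> Type;
  cat_id : forall X, cat_hom X X;
  cat_comp : forall X Y Z, cat_hom Y Z -> cat_hom X Y -> cat_hom X Z;
  cat_compA : forall X Y Z T (h : cat_hom Z T) (g : cat_hom Y Z)
    (f : cat_hom X Y), cat_comp h (cat_comp g f) = cat_comp (cat_comp h g) f;
  cat_comp1f : forall X Y (f : cat_hom X Y), cat_comp (cat_id Y) f = f;
  cat_compf1 : forall X Y (f : cat_hom X Y), cat_comp f (cat_id X) = f }.

Record functor (C D : category) := Functor {
  fun_obj :> C -> D;
  fun_hom : forall X Y : C, cat_hom X Y -> cat_hom (fun_obj X) (fun_obj Y);
  fun_id : forall X : C, fun_hom (cat_id X) = cat_id (fun_obj X);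
  fun_compE : forall (X Y Z : C) (g : cat_hom Y Z) (f : cat_hom X Y),
    fun_hom (cat_comp g f) = cat_comp (fun_hom g) (fun_hom f) }.

Definition functor_id (C : category) : functor C C :=
  @Functor C C (fun X => X) (fun X Y f => f)
    (fun=> erefl) (fun _ _ _ _ _ => erefl).

Lemma functor_comp_id_subproof (C D E : category) (G : functor D E)
  (F : functor C D) (X : C) :
  fun_hom G (fun_hom F (cat_id X)) = cat_id (G (F X)).
Proof. by rewrite !fun_id. Qed.

Lemma functor_comp_comp_subproof (C D E : category) (G : functor D E)
  (F : functor C D) (X Y Z : C) (g : cat_hom Y Z) (f : cat_hom X Y) :
  fun_hom G (fun_hom F (cat_comp g f)) =
  cat_comp (fun_hom G (fun_hom F g)) (fun_hom G (fun_hom F f)).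
Proof. by rewrite !fun_compE. Qed.

Definition functor_comp (C D E : category) (G : functor D E) (F : functor C D) :
    functor C E :=
  @Functor C E (fun X => G (F X)) (fun X Y f => fun_hom G (fun_hom F f))
    (functor_comp_id_subproof G F) (functor_comp_comp_subproof G F).

Definition cat_isomorphism (C D : category) (F : functor C D) : Prop :=
  exists G : functor D C,
    functor_comp G F = functor_id C /\ functor_comp F G = functor_id D.

Definition cat_isomorphic (C D : category) : Prop :=
  exists F : functor C D, cat_isomorphism F.

Lemma structure_hom_inj (S : concrete_site) (X Y : structure S)
  (f g : structure_hom X Y) : sval f = sval g -> f = g.
Proof. exact: eq_sig_hprop. Qed.

Lemma structure_compA (S : concrete_site) (X Y Z T : structure S)
  (h : structure_hom Z T) (g : structure_hom Y Z) (f : structure_hom X Y) :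
  structure_comp h (structure_comp g f) = structure_comp (structure_comp h g) f.
Proof. exact: structure_hom_inj. Qed.

Lemma structure_comp1f (S : concrete_site) (X Y : structure S)
  (f : structure_hom X Y) : structure_comp (structure_id Y) f = f.
Proof. exact: structure_hom_inj. Qed.

Lemma structure_compf1 (S : concrete_site) (X Y : structure S)
  (f : structure_hom X Y) : structure_comp f (structure_id X) = f.
Proof. exact: structure_hom_inj. Qed.

Definition structure_cat (S : concrete_site) : category :=
  Category (@structure_compA S) (@structure_comp1f S) (@structure_compf1 S).

Section Restriction.
Variable R : realType.

Lemma restriction_subproof (X : structure (site_S_star R)) :
  @is_structure (site_S R) X (fun n => @admissible _ X (OmegaObj n)).
Proof.
have [cX pX] := structureP X; split=> [n|m n].
- exact: (cX (OmegaObj n)).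
- exact: (pX (OmegaObj m) (OmegaObj n)).
Qed.

Definition restrict_structure (X : structure (site_S_star R)) :
  structure (site_S R) := Structure (restriction_subproof X).

Definition restrict_hom (X Y : structure (site_S_star R))
    (f : structure_hom X Y) :
    structure_hom (restrict_structure X) (restrict_structure Y) :=
  exist (@structure_morphism (site_S R) (restrict_structure X)
           (restrict_structure Y))
    (sval f) (fun n => svalP f (OmegaObj n)).

Lemma restrict_hom_id (X : structure (site_S_star R)) :
  restrict_hom (structure_id X) = structure_id (restrict_structure X).
Proof. exact: structure_hom_inj. Qed.

Lemma restrict_hom_comp (X Y Z : structure (site_S_star R))
  (g : structure_hom Y Z) (f : structure_hom X Y) :
  restrict_hom (structure_comp g f) =
  structure_comp (restrict_hom g) (restrict_hom f).
Proof. exact: structure_hom_inj. Qed.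

Definition restriction :
    functor (structure_cat (site_S_star R)) (structure_cat (site_S R)) :=
  @Functor (structure_cat (site_S_star R)) (structure_cat (site_S R))
    restrict_structure restrict_hom restrict_hom_id restrict_hom_comp.

End Restriction.

Definition extend_family (R : realType) (X : Type)
    (P : forall n, set (Omega_ R n -> X)) (Q : forall n, set ('rV[R]_n -> X)) :
    map_family (site_S_star R) X :=
  fun C => match C return set (star_pt R C -> X) with
           | OmegaObj n => P n
           | RealObj n => Q n
           end.

Definition real_plots (R : realType) (X : Type)
    (P : forall n, set (Omega_ R n -> X)) (n : nat) : set ('rV[R]_n -> X) :=
  [set c : 'rV[R]_n -> X | P n (fun p : Omega_ R n => c p.1)].

(* Main.v *)
Require Import Defs.
From mathcomp Require Import all_boot all_order all_algebra.
From mathcomp Require Import all_classical all_reals all_analysis.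

Import numFieldNormedType.Exports.

Local Open Scope classical_set_scope.
Local Open Scope ring_scope.

(** For each [n] the projection [pi : R^n x Omega -> R^n] and, for a chosen
    point [w0] of [Omega], the section [t |-> (t, w0)] are morphisms of the
    enlarged site, and [pi] after the section is the identity of [R^n].
    Closure under precomposition with these two morphisms alone therefore
    forces [c] to be admissible on [R^n] exactly when [c \o pi] is admissible on
    [Omega_n] ([real_plots_unique]).

    Conversely this choice of maps on [R^n] is closed under precomposition
    ([real_plots_closed]): for a morphism [h] of the enlarged site with [R^m]
    or [R^n] at either end, the map whose admissibility is required factors as
    an admissible map on [Omega_n] after a pair [(g, Phi)] with [g] mixed-smooth
    and [Phi] the identity or a constant, and such a pair is a morphism of the
    smaller site. Because [R^0] is a point, every map on it is constant.

    Thus a structure over the smaller site has exactly one extension, with the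
    same underlying set. Postcomposition with a map [f] commutes with
    precomposition with [pi], so [f] is a morphism of the extensions as soon as
    it is one of the original structures. Extension and restriction are hence
    mutually inverse functors; as structures are records, the equalities of
    functors amount to equalities of families of admissible maps
    ([functor_eq_id]). *)

(** * Smooth and mixed-smooth maps *)

Lemma smooth_cst (R : realType) (m n : nat) (c : 'rV[R]_n) :
  @smooth R m n (fun=> c).
Proof.
move=> k; elim: k c => [|k IHk] c; split=> //; try exact: cst_continuous.
move=> i; split=> [x|]; first exact: derivable_cst.
have -> : 'D_(delta_mx 0 i) (fun _ : 'rV[R]_m => c) = (fun=> 0).
  by apply/funext => x; rewrite derive_cst.
exact: IHk.
Qed.

Lemma smooth_id (R : realType) (n : nat) : @smooth R n n (fun t => t).
Proof.
case=> [|k] /=; split => //; try by move=> x; exact: cvg_id.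
move=> i; split=> [x|]; first exact: derivable_id.
have -> : 'D_(delta_mx 0 i) (fun t : 'rV[R]_n => t) = (fun=> delta_mx 0 i).
  by apply/funext => x; rewrite derive_id.
exact: smooth_cst.
Qed.

Lemma mixed_smooth_fst (R : realType) (m n : nat) (h : 'rV[R]_m -> 'rV[R]_n) :
  smooth h -> mixed_smooth (fun p : Omega_ R m => h p.1).
Proof.
move=> sh; split=> [w|t]; first exact: sh.
exact: (@measurable_cst _ _ (Omega R) (borel_rV R n) setT (h t)).
Qed.

(** * The unique extension to the spaces [R^n] *)

Section Extension.
Variables (R : realType) (X : Type) (P : forall n, set (Omega_ R n -> X)).

(** The section [t |-> (t, w0)] is not a morphism of the smaller site, so each
    case with a space [R^m] or [R^n] is refactored through the projections,
    keeping the second coordinate or fixing it. *)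
Lemma real_plots_closed : @precomp_closed (site_S R) X P ->
  precomp_closed (extend_family P (real_plots P)).
Proof.
move=> pP [m|m] [n|n] h a /=.
- exact: pP.
- (* a \o h = (a \o pi) \o (h, id) *)
  move=> sh Pa.
  apply: (pP m n (fun p => (h p, p.2)) (fun p => a p.1)) => //.
  by exists h, id; split=> //; exact: measurable_id.
- (* a \o h \o pi = a \o (phi \o pi, w0) *)
  move=> [phi [w0 [sphi ->]]] Pa.
  apply: (pP m n (fun p => (phi p.1, w0)) a) => //.
  exists (fun p => phi p.1), (fun=> w0); split=> //.
  exact: mixed_smooth_fst.
- (* a \o h \o pi = (a \o pi) \o (h \o pi, id) *)
  move=> sh Pa.
  apply: (pP m n (fun p => (h p.1, p.2)) (fun p => a p.1)) => //.
  exists (fun p => h p.1), id; split=> //; exact: mixed_smooth_fst.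
Qed.

(** The two inclusions come from the projection and from one of its sections;
    any point of [Omega] serves for the latter. *)
Lemma real_plots_unique (Q : forall n, set ('rV[R]_n -> X)) :
  precomp_closed (extend_family P Q) -> Q = real_plots P.
Proof.
move=> pQ; apply: functional_extensionality_dep => n.
apply/seteqP; split=> c /=.
- apply: (pQ (OmegaObj n) (RealObj n) (fun p : Omega_ R n => p.1) c).
  by apply: (mixed_smooth_fst R n n (fun t => t)); exact: smooth_id.
- apply: (pQ (RealObj n) (OmegaObj n) (fun t => (t, point : Omega R))
             (fun p => c p.1)).
  by exists (fun t => t), point; split=> //; exact: smooth_id.
Qed.

Lemma real_plots0 : @contains_constants (site_S R) X P ->
  @real_plots R X P 0%N = [set: 'rV[R]_0 -> X].
Proof.
move=> cP; apply/seteqP; split=> // c _ /=.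
suff: (fun p : Omega_ R 0 => c p.1) = (fun=> c 0).
  by rewrite /real_plots /= => ->; exact: cP.
by apply/funext => p; rewrite [p.1]thinmx0.
Qed.

Lemma extend_is_structure : @is_structure (site_S R) X P ->
  is_structure (extend_family P (real_plots P)).
Proof.
move=> [cP pP]; split; last exact: real_plots_closed.
by move=> [n|n] x; exact: (cP n).
Qed.

End Extension.

(** * Equality of functors *)

(** Homs of [F] and [G] live in different types until the objects are identified
    by [e], hence the transport in the second hypothesis. *)
Lemma functor_ext (C D : category) (F G : functor C D)
    (e : forall X : C, F X = G X) :
  (forall (X Y : C) (f : cat_hom X Y),
     match e X in _ = A, e Y in _ = B return cat_hom A B with
     | erefl, erefl => fun_hom F f
     end = fun_hom G f) ->
  F = G.
Proof.
case: F G e => [Fo Fh F1 Fc] [Go Gh G1 Gc] /= e.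
have eo : Fo = Go by apply/funext.
case: Go / eo Gh G1 Gc e => Gh G1 Gc e eh.
have eh' : Fh = Gh.
  apply: functional_extensionality_dep => X.
  apply: functional_extensionality_dep => Y.
  apply/funext => f; rewrite -eh.
  by rewrite (Prop_irrelevance (e X) erefl) (Prop_irrelevance (e Y) erefl).
case: Gh / eh' G1 Gc {eh} => G1 Gc.
by rewrite (Prop_irrelevance F1 G1) (Prop_irrelevance Fc Gc).
Qed.

Lemma structure_eq (S : concrete_site) (X : structure S)
    (P : map_family S X) (sP : is_structure P) :
  P = @admissible S X -> Structure sP = X.
Proof.
by case: X P sP => A Q sQ P sP /= eP; subst P; rewrite (Prop_irrelevance sP sQ).
Qed.

(** Once the two families on the same set are identified, the equations between
    structures become equations of a structure with itself, which have only the
    trivial proof, whatever the proofs [eX] and [eY] were. *)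
Lemma structure_hom_transport (S : concrete_site) (X Y : structure S)
    (P : map_family S X) (sP : is_structure P)
    (Q : map_family S Y) (sQ : is_structure Q)
    (eP : P = @admissible S X) (eQ : Q = @admissible S Y)
    (eX : Structure sP = X) (eY : Structure sQ = Y)
    (f : structure_hom (Structure sP) (Structure sQ)) (g : structure_hom X Y) :
  sval f = sval g ->
  match eX in _ = A, eY in _ = B return structure_hom A B with
  | erefl, erefl => f
  end = g.
Proof.
case: X P sP eP eX f g => A PA sA P sP /= eP; subst P.
case: Y Q sQ eQ eY => B QB sB Q sQ /= eQ; subst Q.
rewrite (Prop_irrelevance sP sA) (Prop_irrelevance sQ sB) => eY eX f g.
rewrite (Prop_irrelevance eX erefl) (Prop_irrelevance eY erefl).
by move=> fg; apply: structure_hom_inj.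
Qed.

(** An endofunctor that replaces only the family of admissible maps of [X]
    keeps underlying sets and maps up to conversion, so no transport is left
    in the hypothesis. Restriction after extension and extension after
    restriction both have this form. *)
Lemma functor_eq_id (S : concrete_site)
    (P : forall X : structure S, map_family S X)
    (sP : forall X : structure S, is_structure (P X))
    (mP : forall (X Y : structure S) (f : structure_hom X Y),
       @structure_morphism S (Structure (sP X)) (Structure (sP Y)) (sval f))
    F1 Fc :
  (forall X : structure S, P X = @admissible S X) ->
  @Functor (structure_cat S) (structure_cat S)
    (fun X => Structure (sP X))
    (fun X Y f => exist _ (sval f) (mP X Y f)) F1 Fc =
  functor_id (structure_cat S).
Proof.
move=> eP.
apply: functor_ext => [X|e X Y f]; first exact: structure_eq.
exact: structure_hom_transport.
Qed.

(** * Extension as a functor inverse to restriction *)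

Section ExtensionFunctor.
Variable R : realType.

Definition extend_structure (X : structure (site_S R)) :
    structure (site_S_star R) :=
  Structure (extend_is_structure R X _ (structureP X)).

Lemma extend_morphism (X Y : structure (site_S R)) (f : structure_hom X Y) :
  @structure_morphism _ (extend_structure X) (extend_structure Y) (sval f).
Proof. by move=> [n|n] a; exact: (svalP f n). Qed.

Definition extend_hom (X Y : structure (site_S R)) (f : structure_hom X Y) :
    structure_hom (extend_structure X) (extend_structure Y) :=
  exist _ (sval f) (extend_morphism X Y f).

Lemma extend_hom_id (X : structure (site_S R)) :
  extend_hom X X (structure_id X) = structure_id (extend_structure X).
Proof. exact: structure_hom_inj. Qed.

Lemma extend_hom_comp (X Y Z : structure (site_S R))
    (g : structure_hom Y Z) (f : structure_hom X Y) :
  extend_hom X Z (structure_comp g f) =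
  structure_comp (extend_hom Y Z g) (extend_hom X Y f).
Proof. exact: structure_hom_inj. Qed.

Definition extension :
    functor (structure_cat (site_S R)) (structure_cat (site_S_star R)) :=
  @Functor (structure_cat (site_S R)) (structure_cat (site_S_star R))
    extend_structure extend_hom extend_hom_id extend_hom_comp.

Lemma extend_restrict_admissible (X : structure (site_S_star R)) :
  @admissible _ (extend_structure (restrict_structure X)) = @admissible _ X.
Proof.
set P := fun n => @admissible _ X (OmegaObj n).
set Q := fun n => @admissible _ X (RealObj n).
have eX : extend_family P Q = @admissible _ X.
  by apply: functional_extensionality_dep => -[].
have eQ : Q = real_plots P.
  by apply: real_plots_unique; rewrite eX; case: (structureP X).
by rewrite -eX {1}eQ.
Qed.

Lemma restriction_extension :
  functor_comp (restriction R) extension = functor_id _.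
Proof.
pose RE X := restrict_structure (extend_structure X).
exact: (functor_eq_id _ (fun X => @admissible _ (RE X))
  (fun X => structureP (RE X))
  (fun X Y f n => svalP (extend_hom X Y f) (OmegaObj n))).
Qed.

Lemma extension_restriction :
  functor_comp extension (restriction R) = functor_id _.
Proof.
pose ER X := extend_structure (restrict_structure X).
apply: (functor_eq_id _ (fun X => @admissible _ (ER X))
  (fun X => structureP (ER X))
  (fun X Y f => extend_morphism _ _ (restrict_hom f))).
exact: extend_restrict_admissible.
Qed.

End ExtensionFunctor.

Theorem proposition3p8 (R : realType) :
  (forall (X : Type) (P : forall n : nat, set (Omega_ R n -> X)),
     @is_structure (site_S R) X P ->
     [/\ precomp_closed (extend_family P (real_plots P)),
         forall Q : forall n : nat, set ('rV[R]_n -> X),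
           precomp_closed (extend_family P Q) -> Q = real_plots P
       & @real_plots R X P 0%N = [set: 'rV[R]_0 -> X]]) /\
  cat_isomorphism (restriction R) /\
  cat_isomorphic (structure_cat (site_S R)) (structure_cat (site_S_star R)).
Proof.
split; last split.
- move=> X P [cP pP]; split.
  + exact: real_plots_closed.
  + exact: real_plots_unique.
  + exact: real_plots0.
- by exists (extension R); rewrite extension_restriction restriction_extension.
- exists (extension R), (restriction R).
  by rewrite extension_restriction restriction_extension.
Qed.
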